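(* Let $M$ be a positive integer and let $d_1,\dots,d_{2M-1}$ be any integers with $1\le d_n<M$ for all $n$. Then there exist subspaces $W_1,\dots,W_{2M-1}$ of $\mathbb{R}^M$ with $\dim W_n=d_n$ for every $n=1,\dots,2M-1$ such that $\{W_n\}_{n=1}^{2M-1}$ allows phase retrieval in $\mathbb{R}^M$.
   Context: Given subspaces $\{W_n\}_{n=1}^N$ of $\mathbb{R}^M$ with orthogonal projections $P_n:\mathbb{R}^M\to W_n$, one says that $\{W_n\}_{n=1}^N$ allows phase retrieval in (or for) $\mathbb{R}^M$ if the map $\mathcal{A}:\mathbb{R}^M/\{\pm1\}\to\mathbb{R}^N$, $\mathcal{A}(x)(n)=\|P_nx\|^2$, is injective; that is, whenever $x,y\in\mathbb{R}^M$ satisfy $\|P_nx\|=\|P_ny\|$ for all $n$, then $x=y$ or $x=-y$. *)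

(* Defs.v *)
From HB Require Import structures.
From mathcomp Require Import all_boot all_order all_algebra.
From mathcomp Require Import reals.

Set Implicit Arguments.
Unset Strict Implicit.
Unset Printing Implicit Defensive.

Import Order.TTheory GRing.Theory Num.Theory.
Local Open Scope ring_scope.

Definition dotr {R : realType} {M : nat} (u v : 'rV[R]_M) : R :=
  \sum_(i < M) u 0 i * v 0 i.

Section DotInstance.
Variables (R : realType) (M : nat).

Fact dotr_bilinear :
  bilinear_for
    (GRing.Scale.Law.clone _ _ ( *%R ) _)
    (GRing.Scale.Law.clone _ _ (idfun \; *%R ) _)
    (@dotr R M).
Proof.
split=> [u'|u] a x y; rewrite /dotr /= mulr_sumr -big_split;
  apply: eq_bigr => i _; rewrite !mxE /=.
- by rewrite mulrDl mulrA.
- by rewrite mulrDr mulrCA.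
Qed.

HB.instance Definition _ :=
  bilinear_isBilinear.Build R _ _ _
    (GRing.Scale.Law.clone _ _ ( *%R ) _)
    (GRing.Scale.Law.clone _ _ (idfun \; *%R ) _)
    (@dotr R M) dotr_bilinear.

Fact dotr_hermitian (u v : 'rV[R]_M) :
  dotr u v = (-1) ^+ false * idfun (dotr v u).
Proof. by rewrite mul1r; apply: eq_bigr => i _; rewrite mulrC. Qed.

HB.instance Definition _ :=
  @isHermitianSesquilinear.Build _ _ _ _ (@dotr R M) dotr_hermitian.

Fact dotr_gt0 (u : 'rV[R]_M) : u != 0 -> 0 < dotr u u.
Proof.
move=> u0; rewrite lt_neqAle sumr_ge0 ?andbT => [|i _]; last exact: sqr_ge0.
apply: contraNneq u0 => /esym /psumr_eq0P u0; apply/eqP/rowP => i.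
apply/eqP; rewrite mxE -[_ == _]orbb -mulf_eq0; apply/eqP.
by apply: u0 => // j _; exact: sqr_ge0.
Qed.

HB.instance Definition _ := isDotProduct.Build _ _ (@dotr R M) dotr_gt0.

End DotInstance.

Definition norm2 {R : realType} {M : nat} (x : 'rV[R]_M) : R :=
  Num.sqrt (dotr x x).

(* The projection onto W along its orthogonal complement; orth_proj_mem and
   orth_proj_orth below characterize it. *)
Definition orth_proj {R : realType} {M : nat} (W : {vspace 'rV[R]_M}) :
  'End('rV[R]_M) := daddv_pi W (orthov (@dotr R M) W).

Lemma cap_orthov (R : realType) (M : nat) (W : {vspace 'rV[R]_M}) :
  (W :&: orthov (@dotr R M) W = 0)%VS.
Proof.
apply/eqP; rewrite -subv0; apply/subvP => u; rewrite memv_cap memv0.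
case/andP=> uW /mem_orthovP/(_ u uW) uu.
by apply: contra_eqT uu => /dotr_gt0/lt0r_neq0.
Qed.

Lemma add_orthov (R : realType) (M : nat) (W : {vspace 'rV[R]_M}) :
  (W + orthov (@dotr R M) W = fullv)%VS.
Proof.
have dim_cap (k : nat) (f : 'I_k -> 'rV[R]_M) :
    (\dim {:'rV[R]_M} <=
      \dim (\bigcap_(i < k) orthov (@dotr R M) <[f i]>) + k)%N.
  elim: k f => [|k IHk] f; first by rewrite big_ord0 addn0.
  rewrite big_ord_recr /= addnS -addSn.
  set V := (\bigcap_(i < k) _)%VS.
  have := leq_dim_orthov1 (@dotr R M) (f ord_max) V.
  have := IHk (fun i => f (widen_ord (leqnSn k) i)).
  rewrite -/V => h1 h2; apply: leq_trans h1 _; rewrite leq_add2r.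
  by rewrite -ltnS; case: (\dim V) h2.
apply/eqP; rewrite -(dimv_leqif_eq (subvf _)).
rewrite eqn_leq dimvS ?subvf //= dimv_disjoint_sum ?cap_orthov // addnC.
have -> : orthov (@dotr R M) W =
    (\bigcap_(i < \dim W) orthov (@dotr R M) <[(vbasis W)`_i]>)%VS.
  by rewrite [LHS]/orthov; apply: eq_bigr => i _; rewrite orthov1E.
exact: dim_cap.
Qed.

Lemma orth_proj_mem (R : realType) (M : nat) (W : {vspace 'rV[R]_M})
  (x : 'rV[R]_M) : orth_proj W x \in W.
Proof. exact: memv_pi. Qed.

Lemma orth_proj_orth (R : realType) (M : nat) (W : {vspace 'rV[R]_M})
  (x w : 'rV[R]_M) : w \in W -> dotr (x - orth_proj W x) w = 0.
Proof.
move=> wW; have xf : x \in (W + orthov (@dotr R M) W)%VS.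
  by rewrite add_orthov memvf.
rewrite -[X in X - _](daddv_pi_add (cap_orthov W) xf) addrC addKr.
have /mem_orthovP/(_ w wW) := memv_pi (orthov (@dotr R M) W) W x.
by [].
Qed.

(* Injectivity of x |-> (||P_n x||^2)_n on R^M / {1, -1}, stated on
   representatives; norms being nonnegative, the squares are dropped. *)
Definition allows_phase_retrieval {R : realType} {M N : nat}
    (W : 'I_N -> {vspace 'rV[R]_M}) : Prop :=
  forall x y : 'rV[R]_M,
    (forall n : 'I_N, norm2 (orth_proj (W n) x) = norm2 (orth_proj (W n) y)) ->
    x = y \/ x = - y.

(* Main.v *)
Require Import Defs.
From mathcomp Require Import all_boot all_order all_algebra perm.
From mathcomp Require Import reals boolp.
From mathcomp Require Import zify ring lra.

(** Write P_n for the orthogonal projection onto W_n. Phase retrieval holds as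
    soon as no nonzero vectors u, v satisfy <P_n u, v> = 0 for all n
    ([allows_phase_retrieval_nondegenerate]). Heuristically this is a dimension
    count: the pairs (u, v) up to scalars have 2M - 2 parameters, and 2M - 1
    generic projections impose 2M - 1 independent conditions. The proof makes
    this count finite and elementary, in two steps.

    For each rank d with 0 < d < M there is a polynomial curve of rank d
    projections (up to a scalar factor) along which <P u, v> is, for all nonzero
    u and v, a nonzero polynomial of degree bounded by a constant D: interpolate
    between finitely many orthonormal frames, chosen so that no (u, v) is
    degenerate for all of them ([frames_nondegenerate]). Sampling the curve
    gives arbitrarily many projections, at most D of which are degenerate for
    any given (u, v) ([projection_family]).

    Now sample s projections for each of the N = 2M - 1 prescribed ranks, and
    consider the s^N ways to choose one projection of each rank. If every choice
    is degenerate, a witness (u, v) for it defines a zero pattern, namely the set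
    of those among the N s sampled forms that vanish at (u, v). Each pattern
    accounts for at most D^N choices. On the other hand, m bilinear forms on
    R^M x R^M realize at most (m + 1)^(2(M - 1)) patterns on pairs of nonzero
    vectors ([card_zero_patterns]). Hence s^(2M - 1) is at most
    D^N (N s + 1)^(2M - 2), which is false for large s. *)

Section PhaseRetrieval.

Set Implicit Arguments.
Unset Strict Implicit.
Unset Printing Implicit Defensive.

Import Order.TTheory GRing.Theory Num.Theory.
Local Open Scope ring_scope.

(** * Phase retrieval as nondegeneracy *)

Section Projection.

Variables (R : realType) (M : nat).
Implicit Types (u v x y : 'rV[R]_M) (W : {vspace 'rV[R]_M}).

Lemma dotr_mx u v : dotr u v = (u *m v^T) 0 0.
Proof. by rewrite mxE; apply: eq_bigr => i _; rewrite mxE. Qed.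

Lemma dotrC u v : dotr u v = dotr v u.
Proof. by apply: eq_bigr => i _; rewrite mulrC. Qed.

Lemma dotrDl u v x : dotr (u + v) x = dotr u x + dotr v x.
Proof. exact: linearDl. Qed.

Lemma dotrDr u v x : dotr x (u + v) = dotr x u + dotr x v.
Proof. exact: linearDr. Qed.

Lemma dotrNr u x : dotr x (- u) = - dotr x u.
Proof. exact: linearNr. Qed.

Lemma dotrNl u x : dotr (- u) x = - dotr u x.
Proof. exact: linearNl. Qed.

Lemma dotr_orth_projl W x w : w \in W -> dotr (orth_proj W x) w = dotr x w.
Proof.
by move=> /(orth_proj_orth x)/eqP; rewrite dotrDl dotrNl subr_eq0 => /eqP.
Qed.

Lemma orth_proj_self_adjoint W x y :
  dotr (orth_proj W x) y = dotr x (orth_proj W y).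
Proof.
rewrite dotrC -(dotr_orth_projl _ (orth_proj_mem W x)) dotrC.
by rewrite (dotr_orth_projl _ (orth_proj_mem W y)).
Qed.

Lemma orth_proj_unique W x z :
  z \in W -> (forall w, w \in W -> dotr (x - z) w = 0) -> orth_proj W x = z.
Proof.
move=> zW xz; apply/eqP; rewrite -subr_eq0; apply: contraT => /dotr_gt0.
have PzW : orth_proj W x - z \in W by rewrite memvB ?orth_proj_mem.
rewrite {1}(_ : _ - z = (x - z) - (x - orth_proj W x)); last first.
  by rewrite opprB [RHS]addrC addrA subrK.
by rewrite dotrDl dotrNl xz // orth_proj_orth // subrr ltxx.
Qed.

Lemma dotr_norm2 x y : norm2 x = norm2 y -> dotr x x = dotr y y.
Proof.
have ge0 (z : 'rV[R]_M) : 0 <= dotr z z by apply: sumr_ge0 => i _; exact: sqr_ge0.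
move=> eq_xy; rewrite -(sqr_sqrtr (ge0 x)) -(sqr_sqrtr (ge0 y)).
by congr (_ ^+ 2); exact: eq_xy.
Qed.

(** If [x] and [y] give equal measurements, then polarization shows that
    [u = x + y] and [v = x - y] satisfy [dotr (P_n u) v = 0] for all [n]. *)
Lemma allows_phase_retrieval_nondegenerate N (W : 'I_N -> {vspace 'rV[R]_M}) :
  (forall u v, u != 0 -> v != 0 -> exists n, dotr (orth_proj (W n) u) v != 0) ->
  allows_phase_retrieval W.
Proof.
move=> Wnd x y eq_norm; have [->|nxy] := eqVneq x y; first by left.
have [/eqP|nxNy] := eqVneq (x + y) 0; first by rewrite addr_eq0 => /eqP; right.
have [|n /negP[]] := Wnd _ _ nxNy (_ : x - y != 0); first by rewrite subr_eq0.
have sq z : dotr (orth_proj (W n) z) z =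
    dotr (orth_proj (W n) z) (orth_proj (W n) z).
  by rewrite [RHS]dotr_orth_projl ?orth_proj_mem // dotrC.
rewrite linearD /= !(dotrDl, dotrDr, dotrNr) !sq (dotr_norm2 (eq_norm n)).
rewrite (orth_proj_self_adjoint _ x) (dotrC x).
by apply/eqP; ring.
Qed.

End Projection.

(** * Projections onto row spaces *)

Section RowSpace.

Variables (R : realType) (M d : nat).
Implicit Types (B : 'M[R]_(d, M)).

Definition rowspace B : {vspace 'rV[R]_M} := limg (linfun (mulmxr B)).

Lemma memv_rowspace B w : reflect (exists x, w = x *m B) (w \in rowspace B).
Proof.
rewrite /rowspace; apply: (iffP memv_imgP) => [[x _ ->]|[x ->]].
  by exists x; rewrite lfunE.
by exists x; rewrite ?memvf ?lfunE.
Qed.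

Lemma dim_rowspace B : row_free B -> \dim (rowspace B) = d.
Proof.
move=> Bfree; rewrite /rowspace limg_dim_eq ?dimvf /dim /= ?mul1n //.
apply/eqP; rewrite -subv0; apply/subvP => x; rewrite memv_cap => /andP[_].
rewrite memv_ker lfunE /= memv0 => /eqP xB0.
by rewrite -(mulmx_free_eq0 _ Bfree) xB0.
Qed.

(** Over the reals, the determinant of [B *m B^T] times the matrix of the
    orthogonal projection onto the row space of [B]. Using the adjugate in
    place of the inverse keeps the entries polynomial in those of [B]. *)
Definition gram_cofactor (S : comNzRingType) (B : 'M[S]_(d, M)) : 'M[S]_M :=
  B^T *m \adj (B *m B^T) *m B.

Lemma gram_row_free B : \det (B *m B^T) != 0 -> row_free B.
Proof.
move=> detB; apply/row_freeP; exists (B^T *m invmx (B *m B^T)).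
by rewrite mulmxA mulmxV // unitmxE unitfE.
Qed.

Lemma orth_proj_rowspace B u : \det (B *m B^T) != 0 ->
  \det (B *m B^T) *: orth_proj (rowspace B) u = u *m gram_cofactor B.
Proof.
set D := \det _ => D0.
suff -> : orth_proj (rowspace B) u = D^-1 *: (u *m gram_cofactor B).
  by rewrite scalerA mulfV // scale1r.
apply: orth_proj_unique => [|w].
  apply/memv_rowspace; exists (D^-1 *: (u *m B^T *m \adj (B *m B^T))).
  by rewrite -scalemxAl !mulmxA.
move=> /memv_rowspace[x ->]; rewrite dotr_mx trmx_mul mulmxA.
suff -> : (u - D^-1 *: (u *m gram_cofactor B)) *m B^T = 0.
  by rewrite mul0mx mxE.
rewrite mulmxBl -scalemxAl /gram_cofactor -!mulmxA mul_adj_mx.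
by rewrite mul_mx_scalar -scalemxAr scalerA mulVf // scale1r subrr.
Qed.

End RowSpace.

(** * Orthonormal frames without common degenerate pair *)

Section Frames.

Variables (R : realType) (M d : nat).
Implicit Types (f : 'I_d.+2 -> 'I_M) (c : R * R) (u v : 'rV[R]_M).

Lemma exists_injection (j k : 'I_M) : (d.+2 <= M)%N -> j != k ->
  exists f, [/\ injective f, f ord0 = j & f ord_max = k].
Proof.
move=> dM njk; set p := widen_ord dM ord0; set q := widen_ord dM ord_max.
have npq : p != q by [].
exists (fun i => tperm (tperm p j q) k (tperm p j (widen_ord dM i))); split.
- by move=> i i' /perm_inj/perm_inj/(congr1 val) /= /val_inj.
- rewrite tpermL tpermD //; last by rewrite eq_sym.
  by rewrite -{2}(tpermL p j) (inj_eq perm_inj) eq_sym.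
- by rewrite -/q tpermL.
Qed.

(** For injective [f] and [c] on the unit circle, an orthonormal frame that spans
    [d] coordinate axes and one line in the plane of the axes [f ord0] and
    [f ord_max]. *)
Definition frame f c : 'M[R]_(d.+1, M) :=
  \matrix_(a, i) if a == ord0 then c.1 *+ (f ord0 == i) + c.2 *+ (f ord_max == i)
                 else (f (widen_ord (leqnSn d.+1) a) == i)%:R.

Lemma mul_frame_tr m f c (A : 'M[R]_(m, M)) b a :
  (A *m (frame f c)^T) b a =
    if a == ord0 then A b (f ord0) * c.1 + A b (f ord_max) * c.2
    else A b (f (widen_ord (leqnSn d.+1) a)).
Proof.
have pick1 (x : R) i : \sum_j A b j * (x *+ (i == j)) = A b i * x.
  rewrite (bigD1 i) //= eqxx mulr1n big1 ?addr0 // => j nij.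
  by rewrite eq_sym (negPf nij) mulr0n mulr0.
rewrite mxE; have [->|na0] := eqVneq a ord0.
  rewrite -!pick1 -big_split; apply: eq_bigr => j _.
  by rewrite !mxE eqxx mulrDr.
rewrite -[RHS]mulr1 -pick1; apply: eq_bigr => j _.
by rewrite !mxE (negPf na0).
Qed.

Lemma frame_orthonormal f c : injective f -> c.1 ^+ 2 + c.2 ^+ 2 = 1 ->
  frame f c *m (frame f c)^T = 1%:M.
Proof.
move=> f_inj c1; apply/matrixP => b a; rewrite mul_frame_tr !mxE.
have wid0 x : (widen_ord (leqnSn d.+1) x == ord0) = (x == ord0) by [].
have widM x : (widen_ord (leqnSn d.+1) x == ord_max) = false.
  by apply/eqP => /(congr1 val) /=; have := ltn_ord x; lia.
have widI x y : (widen_ord (leqnSn d.+1) x == widen_ord (leqnSn d.+1) y) = (x == y).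
  by [].
rewrite !(inj_eq f_inj) !wid0 !widM widI !(eq_sym ord_max) !(eq_sym ord0).
rewrite !wid0 !widM.
have [b0|nb0] := eqVneq b ord0; have [a0|na0] := eqVneq a ord0.
- by rewrite b0 a0 !eqxx /= mulr0n mulr1n addr0 add0r -c1 !expr2.
- by rewrite b0 eq_sym (negPf na0) addr0.
- by rewrite a0 (negPf nb0) !mul0r addr0.
- by [].
Qed.

Lemma frame_form f c u v :
  (u *m (frame f c)^T *m frame f c *m v^T) 0 0 =
    (u 0 (f ord0) * c.1 + u 0 (f ord_max) * c.2) *
    (v 0 (f ord0) * c.1 + v 0 (f ord_max) * c.2) +
    \sum_(a < d) u 0 (f (lift ord0 (widen_ord (leqnSn d) a))) *
                 v 0 (f (lift ord0 (widen_ord (leqnSn d) a))).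
Proof.
rewrite -mulmxA -[frame f c]trmxK -trmx_mul trmxK -dotr_mx /dotr big_ord_recl.
rewrite !mul_frame_tr eqxx; congr (_ + _); apply: eq_bigr => a _.
rewrite !mul_frame_tr /=.
by congr (u 0 (f _) * v 0 (f _)); apply: val_inj.
Qed.

(** Letting the line of a frame be the axis [j], the axis [k] or an oblique line
    of their plane, with the other [d] axes fixed, the vanishing of the three
    forms gives [u_j v_j = u_k v_k] and [u_j v_k + u_k v_j = 0]. All products
    [u_j v_j] are then equal, and a form on coordinate axes is [d.+1] times their
    common value, so they vanish; a nonzero coordinate [u_j] then kills every
    coordinate of [v]. The oblique direction is (3/5, 4/5), which is a rational
    point of the unit circle. *)
Lemma frames_nondegenerate : (d.+2 <= M)%N ->
  exists K (F : 'I_K -> 'M[R]_(d.+1, M)), forall u v, u != 0 -> v != 0 ->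
    exists2 k, F k *m (F k)^T = 1%:M & (u *m (F k)^T *m F k *m v^T) 0 0 != 0.
Proof.
move=> dM; pose cs := [:: (1, 0); (0, 1); (3 / 5, 4 / 5) : R * R].
pose T : finType := ({ffun 'I_d.+2 -> 'I_M} * 'I_3)%type.
pose G (t : T) := frame t.1 (nth (0, 0) cs t.2).
exists #|T|, (fun k => G (enum_val k)) => u v u0 v0.
suff /existsP[t /andP[/injectiveP f_inj nz]] :
    [exists t : T, injectiveb t.1 && ((u *m (G t)^T *m G t *m v^T) 0 0 != 0)].
  exists (enum_rank t); rewrite enum_rankK //; apply: frame_orthonormal => //.
  by case: (t.2) => -[|[|[|]]] //= _; lra.
have vanish : (forall f, injective f -> forall i : 'I_3,
    (u *m (frame f (nth (0, 0) cs i))^T *m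
       frame f (nth (0, 0) cs i) *m v^T) 0 0 = 0) ->
    False.
  move=> form0.
  have pair j k : j != k ->
      exists2 f, f ord0 = j & [/\ u 0 j * v 0 j = u 0 k * v 0 k,
        u 0 j * v 0 k + u 0 k * v 0 j = 0 &
        u 0 j * v 0 j + \sum_(a < d) u 0 (f (lift ord0 (widen_ord (leqnSn d) a))) *
                 v 0 (f (lift ord0 (widen_ord (leqnSn d) a))) = 0].
    move=> njk; have [f [f_inj fj fk]] := exists_injection dM njk.
    exists f => //.
    have := form0 f f_inj (Ordinal (isT : 2 < 3)%N).
    have := form0 f f_inj (Ordinal (isT : 1 < 3)%N).
    have := form0 f f_inj (Ordinal (isT : 0 < 3)%N).
    rewrite !frame_form fj fk /=; set S := \sum_(a < d) _ => e0 e1 e2.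
    by split; lra.
  have diag j k : u 0 j * v 0 j = u 0 k * v 0 k.
    by have [->//|/pair[f _ []]] := eqVneq j k.
  have diag0 j : u 0 j * v 0 j = 0.
    have [k njk] : exists k, j != k.
      have M0 : (0 < M)%N by lia.
      have M1 : (1 < M)%N by lia.
      have [->|] := eqVneq j (Ordinal M0); first by exists (Ordinal M1).
      by exists (Ordinal M0).
    have [f _ [_ _]] := pair j k njk.
    under eq_bigr do rewrite -(diag j).
    rewrite sumr_const card_ord -mulrS => /eqP.
    by rewrite mulrn_eq0 /= => /eqP.
  case/rV0Pn: u0 => j uj0; case/rV0Pn: v0 => k vk0.
  have [ejk|njk] := eqVneq j k.
    by have /eqP := diag0 j; rewrite mulf_eq0 (negPf uj0) ejk (negPf vk0).
  have vj0 : v 0 j = 0 by have /eqP := diag0 j; rewrite mulf_eq0 (negPf uj0) => /eqP.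
  have [f _ [_ /eqP + _]] := pair j k njk.
  by rewrite vj0 mulr0 addr0 mulf_eq0 (negPf uj0) (negPf vk0).
rewrite -[X in is_true X]negbK negb_exists; apply/negP => /forallP nex.
apply: vanish => f f_inj i; have := nex (finfun f, i); rewrite negb_and negbK.
have fE : finfun f =1 f by move=> x; rewrite ffunE.
case/orP => [/injectiveP[]|/eqP]; first exact: eq_inj f_inj (fsym fE).
by rewrite !frame_form !fE; under eq_bigr do rewrite !fE.
Qed.

End Frames.

(** * Curves of projections *)

Section Curve.

Variable R : realType.

Lemma exists_nonroots (p : {poly R}) s : p != 0 ->
  exists2 t : 'I_s -> R, injective t & forall j, p.[t j] != 0.
Proof.
move=> p0; pose r : seq R := [seq i%:R | i <- iota 0 (s + size p)].
have r_uniq : uniq r.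
  by rewrite map_inj_uniq ?iota_uniq // => i j /eqP; rewrite eqr_nat => /eqP.
pose r' := [seq x <- r | ~~ root p x].
have s_le : (s <= size r')%N.
  have lt := max_poly_roots p0 (filter_all (root p) r) (filter_uniq _ r_uniq).
  have e : (size [seq x <- r | root p x] + size r' = s + size p)%N.
    by rewrite !size_filter (count_predC (root p)) size_map size_iota.
  by rewrite -(leq_add2r (size p)) -e addnC leq_add2l ltnW.
exists (fun j => nth 0 r' j) => [i j eq_ij | j].
  have /eqP := eq_ij; rewrite nth_uniq ?filter_uniq //; first by move/eqP/val_inj.
  - exact: leq_trans (ltn_ord i) s_le.
  - exact: leq_trans (ltn_ord j) s_le.
have : nth 0 r' j \in r' by rewrite mem_nth // (leq_trans (ltn_ord j) s_le).
by rewrite mem_filter => /andP[].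
Qed.

(** Lagrange interpolation at the nodes [0, 1, .., K - 1]. *)
Lemma interpolating_curve m n K (F : 'I_K -> 'M[R]_(m, n)) : (0 < K)%N ->
  exists B : 'M[{poly R}]_(m, n),
    forall k : 'I_K, map_mx (horner_eval k%:R) B = F k.
Proof.
move=> K0; pose x (i : nat) : R := i%:R.
have x_inj : injective x by move=> i j /eqP; rewrite eqr_nat => /eqP.
exists (\matrix_(a, i) \sum_k F k a i *: (tnth (lagrange K x) k : {poly R})) => k.
apply/matrixP => a i; rewrite !mxE /horner_eval horner_sum.
rewrite (bigD1 k) //= hornerZ (lagrange_sample K0 x_inj) eqxx mulr1.
rewrite big1 ?addr0 // => k' /negPf nk.
by rewrite hornerZ (lagrange_sample K0 x_inj) nk mulr0.
Qed.

Lemma map_gram_cofactor (S T : comNzRingType) (f : {rmorphism S -> T}) m n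
    (B : 'M[S]_(m, n)) :
  map_mx f (gram_cofactor B) = gram_cofactor (map_mx f B).
Proof. by rewrite /gram_cofactor !map_mxM map_mx_adj map_mxM map_trmx. Qed.

Definition curve_form M (Q : 'M[{poly R}]_M) (u v : 'rV[R]_M) : {poly R} :=
  \sum_i \sum_j (u 0 i * v 0 j) *: Q i j.

Lemma horner_curve_form M (Q : 'M[{poly R}]_M) u v t :
  (curve_form Q u v).[t] = (u *m map_mx (horner_eval t) Q *m v^T) 0 0.
Proof.
rewrite /curve_form horner_sum -mulmxA mxE; apply: eq_bigr => i _.
rewrite horner_sum mxE mulr_sumr; apply: eq_bigr => j _.
by rewrite hornerZ !mxE mulrAC mulrA.
Qed.

Lemma size_curve_form M (Q : 'M[{poly R}]_M) u v :
  (size (curve_form Q u v) <= \max_i \max_j size (Q i j))%N.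
Proof.
rewrite /curve_form; apply: (leq_trans (size_sum _ _ _)); apply/bigmax_leqP => i _.
apply: (leq_trans (size_sum _ _ _)); apply/bigmax_leqP => j _.
apply: leq_trans (size_scale_leq _ _) _.
exact: leq_trans (leq_bigmax j) (leq_bigmax i).
Qed.

(** A polynomial curve of matrices passes through all the frames of
    [frames_nondegenerate]. Along it, for fixed nonzero [u] and [v], the form of
    the cofactor matrix is a polynomial in the parameter; it is nonzero because
    it is nonzero at one of the frames, and its degree is bounded
    independently of [u] and [v]. Any [s] parameters at which the Gram
    determinant does not vanish therefore give a suitable family. *)
Lemma projection_family M d : (1 <= d < M)%N ->
  exists D : nat, forall s : nat, exists2 W : 'I_s -> {vspace 'rV[R]_M},
    (forall j, \dim (W j) = d) &
    forall u v : 'rV[R]_M, u != 0 -> v != 0 ->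
      (#|[set j | dotr (orth_proj (W j) u) v == 0%R]| <= D)%N.
Proof.
case: d => [//|d] /= dM; have [K [F F_nd]] := @frames_nondegenerate R M d dM.
have M0 : (0 < M)%N by lia.
have c0 : (const_mx 1 : 'rV[R]_M) != 0.
  by apply/rV0Pn; exists (Ordinal M0); rewrite mxE oner_eq0.
have [k0 orth0 _] := F_nd _ _ c0 c0.
have K0 : (0 < K)%N by apply: leq_ltn_trans (ltn_ord k0).
have [B BF] := interpolating_curve F K0.
pose Q := gram_cofactor B; pose g := \det (B *m B^T).
have gE t : g.[t] = \det (map_mx (horner_eval t) B *m (map_mx (horner_eval t) B)^T).
  by rewrite map_trmx -map_mxM det_map_mx.
have QE t : map_mx (horner_eval t) Q = gram_cofactor (map_mx (horner_eval t) B).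
  by rewrite map_gram_cofactor.
have form_nz u v : u != 0 -> v != 0 -> curve_form Q u v != 0.
  move=> u0 v0; have [k orth nz] := F_nd u v u0 v0.
  apply: contraNneq nz => Q0; have := horner_curve_form Q u v k%:R.
  rewrite Q0 horner0 QE BF /gram_cofactor orth adj1 mulmx1 => ->.
  by rewrite !mulmxA.
have g0 : g != 0.
  apply: contraTneq (oner_neq0 R) => g0; rewrite negbK.
  by have := gE k0%:R; rewrite g0 horner0 BF orth0 det1 => ->.
exists (\max_i \max_j size (Q i j)) => s.
have [t t_inj gt] := exists_nonroots s g0.
exists (fun j => rowspace (map_mx (horner_eval (t j)) B)) => [j | u v u0 v0].
  by rewrite dim_rowspace // gram_row_free // -gE.
have proj0 j : dotr (orth_proj (rowspace (map_mx (horner_eval (t j)) B)) u) v = 0 ->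
    root (curve_form Q u v) (t j).
  move=> Puv; apply/rootP; rewrite horner_curve_form QE -orth_proj_rowspace -gE //.
  by rewrite -scalemxAl mxE -dotr_mx Puv mulr0.
set Z := [set j | _]; rewrite cardE -(size_map t) ltnW //.
apply: leq_trans (size_curve_form Q u v).
apply: max_poly_roots (form_nz u v u0 v0) _ _.
  by apply/allP => _ /mapP[j + ->]; rewrite mem_enum inE => /eqP/proj0.
by rewrite map_inj_uniq ?enum_uniq.
Qed.

End Curve.

(** * Zero patterns of bilinear forms *)

Section ZeroPatterns.

Variables (F : fieldType) (n : nat).
Implicit Types (u v : 'rV[F]_n.+1) (A : 'M[F]_n.+1).

Definition bform A u v : F := (u *m A *m v^T) 0 0.

Lemma bformE A u v : bform A u v = \sum_(p : 'I_n.+1 * 'I_n.+1)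
  A p.1 p.2 * (u 0 p.1 * v 0 p.2).
Proof.
rewrite /bform -mulmxA mxE -(pair_bigA _ (fun i j => A i j * (u 0 i * v 0 j))) /=.
apply: eq_bigr => i _; rewrite mxE mulr_sumr; apply: eq_bigr => j _.
by rewrite !mxE mulrCA.
Qed.

(** The monomials of degree [m] in [n.+1] variables, indexed by the exponents of
    the last [n] variables. When these exponents sum to more than [m], the
    truncated subtraction yields some other monomial, so the family is only a
    generating one; what matters is that it has at most [m.+1 ^ n] members. *)
Definition monomial m (e : {ffun 'I_n -> 'I_m.+1}) u : F :=
  u 0 ord0 ^+ (m - \sum_i e i) * \prod_(i < n) u 0 (lift ord0 i) ^+ e i.

Lemma prod_coord_monomial (I : finType) (f : I -> 'I_n.+1) u :
  \prod_k u 0 (f k) =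
  monomial [ffun i => inord #|[set k | f k == lift ord0 i]| : 'I_#|I|.+1] u.
Proof.
have fiber i : (#|[set k | f k == i]| < #|I|.+1)%N by rewrite ltnS max_card.
rewrite (partition_big f xpredT) //= big_ord_recl /monomial.
have prodE i : \prod_(k | f k == i) u 0 (f k) = u 0 i ^+ #|[set k | f k == i]|.
  rewrite (eq_bigr (fun=> u 0 i)) => [|k /eqP-> //].
  by rewrite prodr_const cardsE.
congr (_ * _); last by apply: eq_bigr => i _; rewrite prodE ffunE inordK.
rewrite prodE; congr (_ ^+ _).
under eq_bigr do rewrite ffunE inordK //.
rewrite -[in RHS]sum1_card (partition_big f xpredT) //= big_ord_recl.
rewrite -[RHS](addnK 0%N).
have cE i : (\sum_(k | f k == i) 1 = #|[set k | f k == i]|)%N.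
  by rewrite sum1_card cardsE.
by rewrite cE (eq_bigr _ (fun i _ => cE _)) addn0 subn0 addnK.
Qed.

Lemma prod_bform_monomial (I : finType) (A : I -> 'M[F]_n.+1) :
  exists c : {ffun 'I_n -> 'I_#|I|.+1} * {ffun 'I_n -> 'I_#|I|.+1} -> F,
    forall u v, \prod_k bform (A k) u v =
      \sum_e c e * (monomial e.1 u * monomial e.2 v).
Proof.
pose expo (f : I -> 'I_n.+1) : {ffun 'I_n -> 'I_#|I|.+1} :=
  [ffun i => inord #|[set k | f k == lift ord0 i]|].
pose ee (f : {ffun I -> 'I_n.+1 * 'I_n.+1}) :=
  (expo (fun k => (f k).1), expo (fun k => (f k).2)).
exists (fun e => \sum_(f | ee f == e) \prod_k A k (f k).1 (f k).2) => u v.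
under eq_bigr do rewrite bformE.
rewrite bigA_distr_bigA (partition_big ee xpredT) //=.
apply: eq_bigr => e _; rewrite mulr_suml; apply: eq_bigr => f /eqP <-.
by rewrite !big_split /= (prod_coord_monomial (fun k => (f k).1))
   (prod_coord_monomial (fun k => (f k).2)).
Qed.

End ZeroPatterns.

Section ZeroPatternBound.

Variables (F : realFieldType) (n : nat).

(** The linear algebra bound on zero patterns of Ronyai, Babai and Ganapathy,
    for bilinear forms. To each [w] belongs the product [g w] of the forms that
    do not vanish at [w], each other form being replaced by [pad w], which does
    not vanish there either: the padding makes all products bihomogeneous of
    degree [#|I|] in [u] and in [v]. As [g w w'] is nonzero only if the pattern
    of [w'] is contained in that of [w], the functions [g w] are linearly
    independent, and they live in a space spanned by [#|I|.+1 ^ (2 * n)]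
    products of monomials. *)
Lemma card_zero_patterns (I W : finType) (A : I -> 'M[F]_n.+1)
    (u v : W -> 'rV[F]_n.+1) :
  (forall w, u w != 0) -> (forall w, v w != 0) ->
  injective (fun w => [set k | bform (A k) (u w) (v w) == 0]) ->
  (#|W| <= #|I|.+1 ^ (2 * n))%N.
Proof.
set Z := (fun w : W => _) => u0 v0 Z_inj.
pose pad w : 'M[F]_n.+1 := (u w)^T *m v w.
have pad_nz w : bform (pad w) (u w) (v w) != 0.
  have nz (x : 'rV[F]_n.+1) : x != 0 -> (x *m x^T) 0 0 != 0.
    case/rV0Pn => i xi; rewrite mxE psumr_neq0 => [|j _]; last first.
      by rewrite mxE -expr2 sqr_ge0.
    by apply/hasP; exists i; rewrite ?mem_index_enum //= mxE -expr2 exprn_even_gt0.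
  rewrite /bform /pad mulmxA -mulmxA [_ *m _^T]mx11_scalar mul_scalar_mx mxE.
  by rewrite mulf_neq0 // nz.
pose g w w' := \prod_k bform (if k \in Z w then pad w else A k) (u w') (v w').
have g_diag w : g w w != 0.
  by apply/prodf_neq0 => k _; case: ifP => [//|]; rewrite inE => /negbT.
have g_nz w w' : g w w' != 0 -> Z w' \subset Z w.
  move=> /prodf_neq0 gnz; apply/subsetP => k kw'.
  by apply: contraTT kw' => /negPf kw; have := gnz k isT; rewrite kw inE.
pose E := ({ffun 'I_n -> 'I_#|I|.+1} * {ffun 'I_n -> 'I_#|I|.+1})%type.
pose G := \matrix_(i < #|W|, j < #|W|) g (enum_val i) (enum_val j).
have G_free : row_free G.
  (* in a linear relation, evaluate at a pattern of maximal size among those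
     with a nonzero coefficient: all other terms vanish there *)
  apply: inj_row_free => x xG0; apply/eqP; apply: contraT => /rV0Pn[i0 xi0].
  have [i xi imax] := @arg_maxnP _ i0 (fun i => x 0 i != 0)
    (fun i => #|Z (enum_val i)|) xi0.
  have /rowP/(_ i) := xG0; rewrite !mxE (bigD1 i) //= big1 ?addr0 => [/eqP|j nji].
    by rewrite mxE mulf_eq0 (negPf xi) (negPf (g_diag _)).
  rewrite mxE; have [->|xj] := eqVneq (x 0 j) 0; first by rewrite mul0r.
  have [->|/g_nz sZ] := eqVneq (g (enum_val j) (enum_val i)) 0.
    by rewrite mulr0.
  case/eqP: nji; apply/enum_val_inj/Z_inj/esym/eqP.
  by rewrite eqEcard sZ; apply: imax.
have -> : (#|I|.+1 ^ (2 * n) = #|{: E}|)%N.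
  by rewrite card_prod !card_ffun !card_ord -expnD addnn mul2n.
have <- : \rank G = #|W| by apply/eqP.
pose V := \matrix_(e < #|{: E}|, j < #|W|)
  (monomial (enum_val e).1 (u (enum_val j)) *
   monomial (enum_val e).2 (v (enum_val j))).
(* the functions [g w] are combinations of the rows of the evaluation matrix [V] *)
apply: leq_trans (rank_leq_row V); apply: mxrankS; apply/row_subP => i.
pose w := enum_val i.
have [c cE] := prod_bform_monomial (fun k => if k \in Z w then pad w else A k).
apply/submxP; exists (\row_e c (enum_val e)); apply/rowP => j.
rewrite !mxE /g cE (reindex (@enum_val E predT)) /=; last first.
  exact: onW_bij (enum_val_bij _).
by apply: eq_bigr => e _; rewrite !mxE.
Qed.
End ZeroPatternBound.

(** * Counting degenerate choices *)

Section Transversal.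

Variables (F : realFieldType) (n N s D : nat).
Variable A : 'I_N -> 'I_s -> 'M[F]_n.+1.
Hypothesis A_few : forall i (u v : 'rV[F]_n.+1), u != 0 -> v != 0 ->
  (#|[set j | bform (A i j) u v == 0%R]| <= D)%N.

(** If every choice [f] is degenerate, with witness [u f] and [v f], then the zero
    pattern of the witness contains the graph of [f]. A pattern has at most [D]
    points over each [i], so it contains at most [D ^ N] graphs, while the number
    of patterns is bounded by [card_zero_patterns]. *)
Lemma card_degenerate_choices (u v : {ffun 'I_N -> 'I_s} -> 'rV[F]_n.+1) :
  (forall f, u f != 0) -> (forall f, v f != 0) ->
  (forall (f : {ffun 'I_N -> 'I_s}) i, bform (A i (f i)) (u f) (v f) = 0) ->
  (s ^ N <= (N * s).+1 ^ (2 * n) * D ^ N)%N.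
Proof.
move=> u0 v0 uv0.
pose Z f := [set k : 'I_N * 'I_s | bform (A k.1 k.2) (u f) (v f) == 0].
pose P := [set Z f | f : {ffun 'I_N -> 'I_s}].
have preimage (z : {z | z \in P}) : exists f, Z f = val z.
  by case: z => /= z /imsetP[f _ ->]; exists f.
have [r rK] := fin_all_exists preimage.
have P_le : (#|P| <= (N * s).+1 ^ (2 * n))%N.
  have -> : (N * s = #|{: 'I_N * 'I_s}|)%N by rewrite card_prod !card_ord.
  rewrite (_ : #|P| = #|{: {z | z \in P}}|); last first.
    by rewrite card_sig; apply: eq_card.
  apply: (@card_zero_patterns _ _ _ _ (fun k => A k.1 k.2) (u \o r) (v \o r)) =>
    [z|z|z z' eqZ].
  - exact: u0.
  - exact: v0.
  - by apply: val_inj; rewrite -!rK.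
have -> : (s ^ N = #|{: {ffun 'I_N -> 'I_s}}|)%N by rewrite card_ffun !card_ord.
rewrite -sum1_card (partition_big Z (mem P)) => [|f _]; last exact: imset_f.
apply: leq_trans (leq_mul P_le (leqnn _)); rewrite -sum_nat_const.
apply: leq_sum => _ /imsetP[f _ ->].
have fiber_sub : [pred g | Z g == Z f] \subset
    family (fun i => [set j | bform (A i j) (u f) (v f) == 0%R]).
  apply/subsetP => g /eqP Zgf; apply/familyP => i; rewrite inE.
  have : (i, g i) \in Z g by rewrite inE uv0.
  by rewrite Zgf inE.
rewrite sum1_card; apply: (leq_trans (subset_leq_card fiber_sub)).
rewrite card_family; rewrite foldrE big_map big_enum /=.
have -> : (D ^ N = \prod_(i < N) D)%N by rewrite prod_nat_const card_ord.
by apply: leq_prod => i _; apply: A_few.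
Qed.

(** The upper bound of [card_degenerate_choices] has degree [2 * n] in [s]: it is
    smaller than [s ^ N] for [s] large. *)
Lemma exists_nondegenerate_choice :
  (2 * n < N)%N -> (N.+1 ^ (2 * n) * D ^ N < s)%N ->
  exists f : 'I_N -> 'I_s, forall u v : 'rV[F]_n.+1, u != 0 -> v != 0 ->
    exists i, bform (A i (f i)) u v != 0.
Proof.
move=> nN s_big; apply: contrapT => nex.
have degenerate (f : {ffun 'I_N -> 'I_s}) :
    exists w : 'rV[F]_n.+1 * 'rV[F]_n.+1,
      [/\ w.1 != 0, w.2 != 0 & forall i, bform (A i (f i)) w.1 w.2 = 0].
  apply: contrapT => nw; apply: nex; exists f => u v u0 v0.
  apply: contrapT => ni; apply: nw; exists (u, v).
  by split=> // i; apply/eqP/negPn/negP => nz; apply: ni; exists i.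
have [w w_bad] := fin_all_exists degenerate.
have := card_degenerate_choices (fun f => let: And3 h _ _ := w_bad f in h)
  (fun f => let: And3 _ h _ := w_bad f in h)
  (fun f => let: And3 _ _ h := w_bad f in h).
apply/negP; rewrite -ltnNge.
have s0 : (0 < s)%N by apply: leq_ltn_trans s_big.
apply: (@leq_ltn_trans (s ^ (2 * n) * (N.+1 ^ (2 * n) * D ^ N))).
  rewrite mulnA -expnMn leq_mul2r; apply/orP; right.
  by have [->|e0] := posnP (2 * n)%N; rewrite ?expn0 // leq_exp2r //; nia.
apply: (@leq_trans (s ^ (2 * n).+1)); last by rewrite leq_pexp2l.
by rewrite expnS mulnC ltn_pmul2r // expn_gt0 s0.
Qed.

End Transversal.

(** [2 * n] is the number of parameters of a pair of nonzero vectors of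
    [R^n.+1], each taken up to a scalar. *)
Lemma exists_phase_retrieval (R : realType) (n N : nat) (d : 'I_N -> nat) :
  (2 * n < N)%N -> (forall i, 1 <= d i < n.+1)%N ->
  exists W : 'I_N -> {vspace 'rV[R]_n.+1},
    (forall i, \dim (W i) = d i) /\ allows_phase_retrieval W.
Proof.
move=> nN hd; have [D0 fam] := fin_all_exists (fun i => projection_family R (hd i)).
pose D := (\max_i D0 i)%N; pose s := (N.+1 ^ (2 * n) * D ^ N).+1.
have [W W_dim W_few] := fin_all_exists2 (fun i => fam i s).
pose A i j := lin1_mx (orth_proj (W i j)).
have AE i j u v : bform (A i j) u v = dotr (orth_proj (W i j) u) v.
  by rewrite /bform mul_rV_lin1 dotr_mx.
have A_few i (u v : 'rV[R]_n.+1) : u != 0 -> v != 0 ->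
    (#|[set j | bform (A i j) u v == 0%R]| <= D)%N.
  move=> u0 v0; apply: leq_trans (leq_bigmax i).
  apply: leq_trans (W_few i u v u0 v0); apply/eq_leq/eq_card => j.
  by rewrite !inE AE.
have [f f_nd] := exists_nondegenerate_choice A_few nN (ltnSn _).
exists (fun i => W i (f i)); split=> [i|]; first exact: W_dim.
apply: allows_phase_retrieval_nondegenerate => u v u0 v0.
by have [i] := f_nd u v u0 v0; rewrite AE; exists i.
Qed.

End PhaseRetrieval.

Theorem corollary2p6 (R : realType) (M : nat) (hM : (0 < M)%N)
    (d : 'I_(2 * M - 1) -> nat) (hd : forall n, (1 <= d n < M)%N) :
  exists W : 'I_(2 * M - 1) -> {vspace 'rV[R]_M},
    (forall n, \dim (W n) = d n) /\ allows_phase_retrieval W.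
Proof.
case: M hM d hd => // n _ d hd; apply: exists_phase_retrieval => //.
by rewrite mulnS add2n subn1.
Qed.
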